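(* Let $L$ be a $3$-Lie algebra over $F$ and let $n>2$ be an integer. Let $L_n=L\otimes (tF[t]/t^nF[t])$ with bracket $$[x\otimes t^{\bar p},y\otimes t^{\bar q},z\otimes t^{\bar r}]=[x,y,z]_L\otimes t^{\overline{p+q+r}},\qquad x,y,z\in L,\ p,q,r\ge 1.$$ Then $L_n$ is a nilpotent $3$-Lie algebra, and the linear map $D:L_n\to L_n$ with $D(x\otimes t^{\bar p})=p\,(x\otimes t^{\bar p})$ for $x\in L$, $p=1,\dots,n-1$, is an invertible derivation of $L_n$. Moreover, let $\tilde L_n=L_n\oplus L_n^*$ with bracket $$[x+f,y+g,z+h]=[x,y,z]_{L_n}+ad^*(y,z)f-ad^*(x,z)g+ad^*(x,y)h$$ and bilinear form $B(x+f,y+g)=f(y)+g(x)$, for $x,y,z\in L_n$, $f,g,h\in L_n^*$. Then $(\tilde L_n,B)$ is a metric $3$-Lie algebra, the linear map $\tilde D(x+f)=Dx-f\circ D$ is an invertible element of $Der_B(\tilde L_n)$, and $$\omega(x+f,y+g)=B(\tilde D(x+f),y+g)=-f(Dy)+g(Dx)$$ is a symplectic structure on $\tilde L_n$. In particular $(\tilde L_n,B,\omega)$ is a metric symplectic $3$-Lie algebra for every integer $n>2$.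
   Context: $F$ is an algebraically closed field of characteristic zero. $F[t]$ is the polynomial algebra over $F$ and $t^{\bar p}$ denotes the class of $t^p$ in $tF[t]/t^nF[t]$ (zero if $p\ge n$). $\oplus$ is the direct sum of vector spaces and $L_n^*$ is the dual space. A $3$-Lie algebra over $F$ is an $F$-vector space $L$ with a trilinear, totally skew-symmetric bracket satisfying $[[x_1,x_2,x_3],y_2,y_3]=[[x_1,y_2,y_3],x_2,x_3]+[x_1,[x_2,y_2,y_3],x_3]+[x_1,x_2,[x_3,y_2,y_3]]$ for all elements. It is nilpotent if $L^s=0$ for some $s\ge 0$, where $L^0=L$ and $L^s=[L^{s-1},L,L]$. A derivation is a linear map $D$ with $D[x,y,z]=[Dx,y,z]+[x,Dy,z]+[x,y,Dz]$. For a $3$-Lie algebra $A$, $ad^*:A\wedge A\to End(A^* )$ is given by $(ad^*(x,y)f)(z)=-f([x,y,z])$. A metric on a $3$-Lie algebra $A$ is a non-degenerate symmetric bilinear form $B$ with $B([x_1,x_2,x_3],x_4)+B(x_3,[x_1,x_2,x_4])=0$ for all $x_i$; $(A,B)$ is then a metric $3$-Lie algebra, and $Der_B(A)$ is the set of derivations $D$ of $A$ with $B(Dx,y)+B(x,Dy)=0$ for all $x,y$. A symplectic structure on $A$ is a non-degenerate skew-symmetric bilinear form $\omega$ with $\omega([x_2,x_3,x_4],x_1)-\omega([x_1,x_3,x_4],x_2)+\omega([x_1,x_2,x_4],x_3)-\omega([x_1,x_2,x_3],x_4)=0$ for all $x_i\in A$. If $A$ carries both a metric $B$ and a symplectic structure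 $\omega$, then $(A,B,\omega)$ is called a metric symplectic $3$-Lie algebra. *)

(* Defs.v *)
From HB Require Import structures.
From mathcomp Require Import all_boot all_order all_algebra.
From mathcomp Require Import qpoly.
From mathcomp Require Import boolp classical_sets.

Set Implicit Arguments.
Unset Strict Implicit.
Unset Printing Implicit Defensive.

Import GRing.Theory.
Local Open Scope classical_set_scope.
Local Open Scope ring_scope.

(* Vector spaces are arbitrary lmodTypes: no dimension is assumed finite. *)

Section MultilinearMaps.
Variable F : fieldType.

Definition bilinear_map (U V W : lmodType F) (b : U -> V -> W) : Prop :=
  (forall v, linear (fun u => b u v)) /\ (forall u, linear (b u)).

Definition bilinear_form (V : lmodType F) (B : V -> V -> F) : Prop :=
  @bilinear_map V V F^o B.

(* Trivial radical; one side is enough, as this is only applied to symmetric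
   and to skew-symmetric forms. *)
Definition nondegenerate_form (V : lmodType F) (B : V -> V -> F) : Prop :=
  forall x, (forall y, B x y = 0) -> x = 0.

Definition trilinear (V : lmodType F) (br : V -> V -> V -> V) : Prop :=
  [/\ forall y z, linear (fun x => br x y z),
      forall x z, linear (fun y => br x y z) &
      forall x y, linear (br x y)].

Record trilinear_op (V : lmodType F) := TrilinearOp {
  trilinear_fun :> V -> V -> V -> V;
  trilinearP : trilinear trilinear_fun
}.

(* Universal property of T = U (x) V with pure tensors tens u v. *)
Definition is_tensor_product (U V T : lmodType F) (tens : U -> V -> T) : Prop :=
  bilinear_map tens /\
  forall (Z : lmodType F) (b : U -> V -> Z), bilinear_map b ->
    exists2 f : {linear T -> Z},
      forall u v, f (tens u v) = b u v &
      forall g : {linear T -> Z}, (forall u v, g (tens u v) = b u v) -> g =1 f.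

Definition lspan (V : lmodType F) (S : set V) : set V :=
  [set v | exists m (a : 'I_m -> F) (s : 'I_m -> V),
     (forall i, S (s i)) /\ v = \sum_i a i *: s i].

End MultilinearMaps.

Section DualSpace.
Variables (F : fieldType) (V : lmodType F).

Definition dual := {linear V -> F^o}.

Lemma dual_ext (f g : dual) : (forall x, f x = g x) -> f = g.
Proof.
case: f g => f [[fa] [fb]] [g [[ga] [gb]]] /= fg.
have {}fg : f = g by apply/funext.
rewrite -fg in ga gb *.
by rewrite (Prop_irrelevance fa ga) (Prop_irrelevance fb gb).
Qed.

HB.instance Definition _ := gen_eqMixin dual.
HB.instance Definition _ := gen_choiceMixin dual.

Definition dual0 : dual := (\0 : {linear V -> F^o}).
Definition dual_opp (f : dual) : dual := (\- f : {linear V -> F^o}).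
Definition dual_add (f g : dual) : dual := (f \+ g : {linear V -> F^o}).
Definition dual_scale (a : F) (f : dual) : dual := (a \*: f : {linear V -> F^o}).

Fact dual_addA : associative dual_add.
Proof. by move=> f g h; apply: dual_ext => x /=; rewrite addrA. Qed.
Fact dual_addC : commutative dual_add.
Proof. by move=> f g; apply: dual_ext => x /=; rewrite addrC. Qed.
Fact dual_add0 : left_id dual0 dual_add.
Proof. by move=> f; apply: dual_ext => x /=; rewrite add0r. Qed.
Fact dual_addN : left_inverse dual0 dual_opp dual_add.
Proof. by move=> f; apply: dual_ext => x /=; rewrite addNr. Qed.

HB.instance Definition _ :=
  GRing.isZmodule.Build dual dual_addA dual_addC dual_add0 dual_addN.

Fact dual_scaleA a b (f : dual) :
  dual_scale a (dual_scale b f) = dual_scale (a * b) f.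
Proof. by apply: dual_ext => x /=; rewrite scalerA. Qed.
Fact dual_scale1 : left_id 1 dual_scale.
Proof. by move=> f; apply: dual_ext => x /=; rewrite scale1r. Qed.
Fact dual_scaleDr : right_distributive dual_scale +%R.
Proof. by move=> a f g; apply: dual_ext => x /=; rewrite scalerDr. Qed.
Fact dual_scaleDl f : {morph dual_scale^~ f : a b / a + b}.
Proof. by move=> a b; apply: dual_ext => x /=; rewrite scalerDl. Qed.

HB.instance Definition _ := GRing.Zmodule_isLmodule.Build F dual
  dual_scaleA dual_scale1 dual_scaleDr dual_scaleDl.

Definition dual_comp (f : dual) (D : {linear V -> V}) : dual :=
  (f \o D : {linear V -> F^o}).

End DualSpace.

Section ThreeLie.
Variable F : fieldType.
Implicit Type V : lmodType F.

(* Skew-symmetry is stated on the two adjacent transpositions. *)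
Definition is_threeLie V (br : V -> V -> V -> V) : Prop :=
  [/\ trilinear br,
      forall x y z, br y x z = - br x y z,
      forall x y z, br x z y = - br x y z &
      forall x1 x2 x3 y2 y3,
        br (br x1 x2 x3) y2 y3 =
          br (br x1 y2 y3) x2 x3 + br x1 (br x2 y2 y3) x3
          + br x1 x2 (br x3 y2 y3)].

Fixpoint lower_central V (br : V -> V -> V -> V) (s : nat) : set V :=
  if s is s'.+1 then
    lspan [set v | exists x y z, lower_central br s' x /\ v = br x y z]
  else setT.

Definition nilpotent_threeLie V (br : V -> V -> V -> V) : Prop :=
  exists s, lower_central br s = [set 0].

Definition is_derivation V (br : V -> V -> V -> V) (D : V -> V) : Prop :=
  linear D /\
  forall x y z, D (br x y z) = br (D x) y z + br x (D y) z + br x y (D z).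

Definition is_metric V (br : V -> V -> V -> V) (B : V -> V -> F) : Prop :=
  [/\ bilinear_form B,
      forall x y, B x y = B y x,
      nondegenerate_form B &
      forall x1 x2 x3 x4, B (br x1 x2 x3) x4 + B x3 (br x1 x2 x4) = 0].

Definition is_metric_threeLie V (br : V -> V -> V -> V) (B : V -> V -> F) :
    Prop :=
  is_threeLie br /\ is_metric br B.

Definition is_DerB V (br : V -> V -> V -> V) (B : V -> V -> F) (D : V -> V) :
    Prop :=
  is_derivation br D /\ forall x y, B (D x) y + B x (D y) = 0.

Definition is_symplectic_structure V (br : V -> V -> V -> V)
    (w : V -> V -> F) : Prop :=
  [/\ bilinear_form w,
      forall x y, w x y = - w y x,
      nondegenerate_form w &
      forall x1 x2 x3 x4,
        w (br x2 x3 x4) x1 - w (br x1 x3 x4) x2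
        + w (br x1 x2 x4) x3 - w (br x1 x2 x3) x4 = 0].

Definition is_metric_symplectic V (br : V -> V -> V -> V)
    (B w : V -> V -> F) : Prop :=
  is_metric_threeLie br B /\ is_symplectic_structure br w.

End ThreeLie.

Section CoadjointExtension.
Variables (F : fieldType) (V : lmodType F).

Section Coadjoint.
Variables (br : trilinear_op V) (x y : V) (f : dual V).

Definition coad_fun (z : V) : F^o := - f (br x y z).

Fact coad_is_linear : linear coad_fun.
Proof.
have [_ _ H3] := trilinearP br.
by move=> a u v; rewrite /coad_fun (H3 x y) linearP opprD scalerN.
Qed.

HB.instance Definition _ :=
  GRing.isLinear.Build F V F^o _ coad_fun coad_is_linear.

Definition coad : dual V := (coad_fun : {linear V -> F^o}).
End Coadjoint.

(* The element x + f of V (+) V^* is the pair (x, f). *)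
Definition coext_bracket (br : trilinear_op V) (u v w : V * dual V) :
    V * dual V :=
  (br u.1 v.1 w.1,
   coad br v.1 w.1 u.2 - coad br u.1 w.1 v.2 + coad br u.1 v.1 w.2).

Definition coext_form (u v : V * dual V) : F := u.2 v.1 + v.2 u.1.

Definition coext_map (D : {linear V -> V}) (u : V * dual V) : V * dual V :=
  (D u.1, - dual_comp u.2 D).

Definition coext_omega (D : {linear V -> V}) (u v : V * dual V) : F :=
  coext_form (coext_map D u) v.

End CoadjointExtension.

Section TruncatedPolynomials.
Variables (F : fieldType) (n : nat).

(* The image of tF[t] in F[t]/t^nF[t], for n > 0. *)
Definition tquot_pred : {pred {poly %/ ('X^n : {poly F})}} :=
  fun q => `[< exists p : {poly F}, q = in_qpoly 'X^n ('X * p) >].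

Fact tquot_submod_closed : submod_closed tquot_pred.
Proof.
split.
  by apply/asboolP; exists 0; rewrite mulr0 linear0.
move=> a _ _ /asboolP[p ->] /asboolP[q ->]; apply/asboolP.
by exists (a *: p + q); rewrite mulrDr -scalerAr linearP.
Qed.

HB.instance Definition _ :=
  GRing.isSubmodClosed.Build F _ tquot_pred tquot_submod_closed.

Record tquot := TQuot {
  tquot_val :> {poly %/ ('X^n : {poly F})};
  _ : tquot_val \in tquot_pred
}.

HB.instance Definition _ := [isSub for tquot_val].
HB.instance Definition _ := [Choice of tquot by <:].
HB.instance Definition _ := [SubChoice_isSubLmodule of tquot by <:].

(* The class of t^p for p >= 1 (see tbarE); the value at p = 0 is junk. *)
Definition tbar (p : nat) : tquot := insubd 0 (in_qpoly 'X^n 'X^p).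

Lemma tbarE p : (0 < p)%N -> tquot_val (tbar p) = in_qpoly 'X^n 'X^p.
Proof.
case: p => // p _; rewrite -[LHS]/(val _) val_insubd ifT//.
by apply/asboolP; exists 'X^p; rewrite exprS.
Qed.

Lemma tbar_eq0 p : (0 < n <= p)%N -> tbar p = 0.
Proof.
case/andP=> n_gt0 le_np; apply: val_inj => /=.
rewrite tbarE ?(leq_trans n_gt0)//; apply/val_inj => /=.
rewrite mk_monic_Xn prednK// -(subnK le_np) exprD.
by rewrite Pdiv.RingMonic.rmodp_mull ?monicXn.
Qed.

End TruncatedPolynomials.

Section TensorExistence.
Variables (F : fieldType) (n : nat).

Definition tcoef (i : nat) (w : tquot F n) : F^o := (polyn (tquot_val w))`_i.

Fact tcoef_is_linear i : linear (tcoef i).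
Proof. by move=> a u v; rewrite /tcoef /= coefD coefZ. Qed.

HB.instance Definition _ i :=
  GRing.isLinear.Build F (tquot F n) F^o _ (tcoef i) (tcoef_is_linear i).

Hypothesis n_gt1 : (1 < n)%N.

Let mX : mk_monic ('X^n) = 'X^n :> {poly F}.
Proof. by rewrite mk_monic_Xn prednK// ltnW. Qed.

Let ordS_bound (i : 'I_n.-1) : (0 < i.+1 < n)%N.
Proof. by rewrite /= -ltn_predRL. Qed.

Lemma tcoef_tbar p i : (0 < p < n)%N -> tcoef i (tbar F n p) = (i == p)%:R.
Proof.
move=> /andP[p0 pn]; rewrite /tcoef tbarE//= mX.
by rewrite Pdiv.CommonRing.rmodp_small ?coefXn// !size_polyXn.
Qed.

Lemma tcoef_inj u v :
  (forall i : 'I_n.-1, tcoef i.+1 u = tcoef i.+1 v) -> u = v.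
Proof.
have cf0 w : tcoef 0 w = 0.
  case: w => w w_in; case/asboolP: (w_in) => p wE; rewrite /tcoef /= wE /= mX.
  have E := Pdiv.RingMonic.rdivp_eq (monicXn F n) ('X * p).
  have := congr1 (fun q : {poly F} => q`_0) E.
  by rewrite coefXM coefD coefMXn (ltnW n_gt1) add0r => <-.
have cfbig w i : (n <= i)%N -> tcoef i w = 0.
  move=> ni; rewrite /tcoef nth_default// (leq_trans _ ni)//.
  by have := size_npoly (tquot_val w); rewrite {2}mX size_polyXn.
move=> uv; apply/val_inj/val_inj/polyP => i /=.
rewrite -/(tcoef i u) -/(tcoef i v).
case: i => [|i]; first by rewrite !cf0.
case: (leqP n i.+1) => [ni|]; first by rewrite !cfbig.
move=> lt_in; have lt_i : (i < n.-1)%N by rewrite -ltnS prednK// ltnW.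
exact: (uv (Ordinal lt_i)).
Qed.

Lemma tquot_expand (w : tquot F n) :
  w = \sum_(i < n.-1) (tcoef i.+1 w : F) *: tbar F n i.+1.
Proof.
apply: tcoef_inj => j.
rewrite linear_sum (bigD1 j)//= big1 ?addr0 => [|i ij].
  rewrite linearZ /= tcoef_tbar ?eqxx; first by rewrite [RHS]mulr1.
  exact: ordS_bound.
rewrite linearZ /= tcoef_tbar; last exact: ordS_bound.
by rewrite eqSS eq_sym (inj_eq val_inj) (negPf ij) [LHS]mulr0.
Qed.

Let lin_of (U V : lmodType F) (g : U -> V) (gl : linear g) : {linear U -> V} :=
  HB.pack g (GRing.isLinear.Build F U V *:%R g gl).

(* A tensor product of L with tF[t]/t^nF[t] exists: families of coefficients. *)
Lemma tensor_product_exists (L : lmodType F) :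
  exists (T : lmodType F) (tens : L -> tquot F n -> T), is_tensor_product tens.
Proof.
pose tens (x : L) (w : tquot F n) : {ffun 'I_n.-1 -> L} :=
  [ffun i : 'I_n.-1 => (tcoef i.+1 w : F) *: x].
have bt : bilinear_map tens.
  split=> [w a x y|x a u v]; apply/ffunP => i; rewrite !ffunE.
    by rewrite scalerDr !scalerA mulrC.
  by rewrite linearP /= scalerDl scalerA.
exists {ffun 'I_n.-1 -> L}, tens; split=> // Z b [bl br].
pose bL w : {linear L -> Z} := lin_of (bl w).
pose bR x : {linear tquot F n -> Z} := lin_of (br x).
pose f (g : {ffun 'I_n.-1 -> L}) : Z := \sum_i b (g i) (tbar F n i.+1).
have fl : linear f.
  move=> a g h; rewrite /f scaler_sumr -big_split; apply: eq_bigr => i _ /=.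
  by rewrite !ffunE bl.
exists (lin_of fl) => [x w|g gb h] /=.
  rewrite {2}(tquot_expand w) -[b x _]/(bR x _) linear_sum.
  apply: eq_bigr => i _; rewrite ffunE -[b _ _]/(bL _ _) linearZ /=.
  by rewrite -[b x _]/(bR x _) -linearZ.
have hE : \sum_i tens (h i) (tbar F n i.+1) = h.
  apply/ffunP => j; rewrite sum_ffunE (bigD1 j)//= big1 ?addr0 => [|i ij].
    by rewrite ffunE tcoef_tbar ?ordS_bound// eqxx scale1r.
  rewrite ffunE tcoef_tbar; last exact: ordS_bound.
  by rewrite eqSS eq_sym (inj_eq val_inj) (negPf ij) scale0r.
by rewrite -{1}hE linear_sum /f; apply: eq_bigr => j _; rewrite gb.
Qed.

End TensorExistence.

Section TruncatedCurrentAlgebra.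
Variables (F : fieldType) (L T : lmodType F) (n : nat).
Variable tens : L -> tquot F n -> T.

Definition is_truncated_bracket (brL : L -> L -> L -> L)
    (br : T -> T -> T -> T) : Prop :=
  forall x y z p q r, (0 < p)%N -> (0 < q)%N -> (0 < r)%N ->
    br (tens x (tbar F n p)) (tens y (tbar F n q)) (tens z (tbar F n r)) =
      tens (brL x y z) (tbar F n (p + q + r)).

Definition is_degree_map (D : T -> T) : Prop :=
  forall x p, (0 < p < n)%N ->
    D (tens x (tbar F n p)) = p%:R *: tens x (tbar F n p).

End TruncatedCurrentAlgebra.

(* Main.v *)
Require Import Defs.
From HB Require Import structures.
From mathcomp Require Import all_boot all_order all_algebra.
From mathcomp Require Import qpoly.
From mathcomp Require Import boolp classical_sets.
From mathcomp Require Import ring.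

Set Implicit Arguments.
Unset Strict Implicit.
Unset Printing Implicit Defensive.

Import GRing.Theory.
Local Open Scope ring_scope.

(** The bracket and the degree map D on the tensor product are determined by
    their values on the pure tensors x (x) t^p, 0 < p < n, which span
    (tensor_ind); they exist because the universal property provides the
    coefficients c u i in L of the expansion u = \sum_i c u i (x) t^(i+1)
    (tensor_coordinates).  Every identity for the bracket of Ln, the derivation
    rule for D included, is checked on pure tensors, where it reduces to the
    corresponding identity in L together with an addition of exponents.  All
    exponents are positive, so bracketing raises the order in t and the lower
    central series dies out at t^n (bracket_raises_order).  In characteristic
    zero the weights p = 1, ..., n-1 of D are invertible scalars, hence so is D.

    The rest holds over any field, for any 3-Lie algebra A with an invertible
    derivation D.  The coadjoint map satisfies the two identities of a
    representation (coad_comm and coad_bracket), which are the dual components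
    of the fundamental identity on A + A^*.  The second of them rests on
    fundamental_mixed, which is not an instance of the fundamental identity but
    a combination of several.  Since A may have infinite dimension,
    nondegeneracy of the pairing form uses the fact that linear forms separate
    the points of a vector space (dual_separates), obtained from Zorn's lemma.
    The extension x + f |-> D x - f o D of D is skew for the pairing by
    construction.  For a metric B and an injective E in Der_B, the closedness of
    w(u, v) = B(E u, v) is the derivation rule for E: by total skew-symmetry of
    the 4-form (a, b, c, d) |-> B([a, b, c], d), the cyclic sum for w is the
    effect of E on this 4-form, which is zero (symplectic_of_DerB). *)

(** * Linear and trilinear maps *)

Definition lin_of (F : fieldType) (U V : lmodType F) (g : U -> V)
    (gl : linear g) : {linear U -> V} :=
  HB.pack g (GRing.isLinear.Build F U V *:%R g gl).

Section TrilinearOperations.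
Variables (F : fieldType) (V : lmodType F) (br : trilinear_op V).
Implicit Types x y z : V.

Let lin_l y z : {linear V -> V} :=
  lin_of (let: And3 H _ _ := trilinearP br in H y z).
Let lin_m x z : {linear V -> V} :=
  lin_of (let: And3 _ H _ := trilinearP br in H x z).
Let lin_r x y : {linear V -> V} :=
  lin_of (let: And3 _ _ H := trilinearP br in H x y).

Lemma brPl a x x' y z : br (a *: x + x') y z = a *: br x y z + br x' y z.
Proof. exact: (linearP (lin_l y z)). Qed.
Lemma brPm a x y y' z : br x (a *: y + y') z = a *: br x y z + br x y' z.
Proof. exact: (linearP (lin_m x z)). Qed.
Lemma brPr a x y z z' : br x y (a *: z + z') = a *: br x y z + br x y z'.
Proof. exact: (linearP (lin_r x y)). Qed.

Lemma brDl x x' y z : br (x + x') y z = br x y z + br x' y z.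
Proof. exact: (linearD (lin_l y z)). Qed.
Lemma brDm x y y' z : br x (y + y') z = br x y z + br x y' z.
Proof. exact: (linearD (lin_m x z)). Qed.
Lemma brDr x y z z' : br x y (z + z') = br x y z + br x y z'.
Proof. exact: (linearD (lin_r x y)). Qed.

Lemma br0l y z : br 0 y z = 0. Proof. exact: (linear0 (lin_l y z)). Qed.
Lemma br0m x z : br x 0 z = 0. Proof. exact: (linear0 (lin_m x z)). Qed.
Lemma br0r x y : br x y 0 = 0. Proof. exact: (linear0 (lin_r x y)). Qed.

Lemma brNl x y z : br (- x) y z = - br x y z.
Proof. exact: (linearN (lin_l y z)). Qed.

Lemma brZl a x y z : br (a *: x) y z = a *: br x y z.
Proof. by rewrite -[a *: x]addr0 brPl br0l addr0. Qed.
Lemma brZm a x y z : br x (a *: y) z = a *: br x y z.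
Proof. by rewrite -[a *: y]addr0 brPm br0m addr0. Qed.
Lemma brZr a x y z : br x y (a *: z) = a *: br x y z.
Proof. by rewrite -[a *: z]addr0 brPr br0r addr0. Qed.

Lemma br_suml I (r : seq I) (P : pred I) (f : I -> V) y z :
  br (\sum_(i <- r | P i) f i) y z = \sum_(i <- r | P i) br (f i) y z.
Proof. exact: (linear_sum (lin_l y z)). Qed.

End TrilinearOperations.

Lemma addr3ACA (V : zmodType) (a b c a' b' c' : V) :
  a + b + c + (a' + b' + c') = (a + a') + (b + b') + (c + c').
Proof. by rewrite addrACA; congr (_ + _); rewrite addrACA. Qed.

(** * Linear forms separate points *)

Section SeparatingFunctional.
Local Open Scope classical_set_scope.
Variables (F : fieldType) (V : lmodType F).

(** Subspaces, except that the empty set is allowed: the union of the empty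
    chain has to satisfy the property to which Zorn's lemma is applied. *)
Definition linear_stable (A : set V) : Prop :=
  forall (a : F) u v, A u -> A v -> A (a *: u + v).

(** For x != 0, a subspace M maximal among those that miss x is a hyperplane
    complementary to the line of x, and the coordinate of a vector along x
    modulo M is a linear form with value 1 at x. *)
Lemma dual_separates (x : V) : (forall f : dual V, f x = 0) -> x = 0.
Proof.
move=> fx0; apply: contrapT => x_neq0.
pose P (A : set V) := linear_stable A /\ ~ A x.
have [M [[Mlin Mx] Mmax]] : exists A, P A /\ forall B, A `<` B -> ~ P B.
  apply: Zorn_bigcup => S SP Stot.
  split=> [a u v [A SA Au] [B SB Bv]|[A SA Ax]].
    have [AB|BA] := Stot _ _ SA SB.
      by exists B => //; apply: (SP _ SB).1 => //; apply: AB.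
    by exists A => //; apply: (SP _ SA).1 => //; apply: BA.
  exact: (SP _ SA).2.
have Mopp m : M m -> M (- m).
  move=> Mm; have := Mlin (-1) _ _ Mm (Mlin (-1) _ _ Mm Mm).
  by rewrite scaleN1r [- m + m]addNr addr0.
(* Adding 0 to M would otherwise contradict maximality. *)
have M0 : M 0.
  apply: contrapT => M0n; apply: (Mmax (M `|` [set 0])).
    split=> [u Mu|sub]; first by left.
    by apply: M0n; apply: sub; right.
  split=> [a u v|[]//] [Mu|->] [Mv|->].
  - by left; apply: Mlin.
  - left; have := Mlin (a - 1) _ _ Mu Mu.
    by rewrite addr0 scalerBl scale1r subrK.
  - by left; rewrite scaler0 add0r.
  - by right; rewrite scaler0 add0r.
have Mscale a m : M m -> M (a *: m).
  by move=> Mm; rewrite -[_ *: _]addr0; apply: Mlin.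
have Madd u v : M u -> M v -> M (u + v).
  by move=> Mu Mv; rewrite -[u]scale1r; apply: Mlin.
(* For v outside M, maximality puts x in M + F v: x - a v lies in M with a
   nonzero, so that c = a^-1 is the coordinate of v. *)
have ex_coef v : exists c : F, M (v - c *: x).
  apply: contrapT => nc.
  have Mv : ~ M v by move=> Mv; apply: nc; exists 0; rewrite scale0r subr0.
  apply: (Mmax [set w | exists a : F, M (w - a *: v)]).
    split=> [u Mu|sub]; first by exists 0; rewrite scale0r subr0.
    by apply: Mv; apply: sub; exists 1; rewrite scale1r subrr.
  split=> [a u w [b Mb] [d Md]|[a Ma]].
    exists (a * b + d).
    rewrite scalerDl -scalerA opprD addrACA -scalerBr; exact: Mlin.
  apply: nc; exists a^-1.
  have a_neq0 : a != 0.
    by apply/eqP => a0; apply: Mx; rewrite a0 scale0r subr0 in Ma.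
  have -> : v - a^-1 *: x = - (a^-1 *: (x - a *: v)).
    by rewrite scalerBr scalerA mulVf// scale1r opprB.
  exact/Mopp/Mscale.
have coef_uniq v c d : M (v - c *: x) -> M (v - d *: x) -> c = d.
  move=> Mc Md; apply/eqP; rewrite -subr_eq0; apply: contrapT => /negP cd.
  apply: Mx; have -> : x = (c - d)^-1 *: ((v - d *: x) - (v - c *: x)).
    rewrite opprB [_ + (_ - v)]addrC addrA subrK -scalerBl scalerA.
    by rewrite mulVf// scale1r.
  by apply: Mscale; apply: Madd => //; apply: Mopp.
have [c cP] := choice ex_coef.
have c_lin : linear (c : V -> F^o).
  move=> a u v; apply: (coef_uniq (a *: u + v)) => //.
  rewrite scalerDl -scalerA opprD addrACA -scalerBr; exact: Mlin.
have := fx0 (lin_of c_lin) => /= cx0.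
by have := cP x; rewrite cx0 scale0r subr0.
Qed.

End SeparatingFunctional.

(** * Identities in a 3-Lie algebra *)

Section ThreeLieIdentities.
Variables (F : fieldType) (V : lmodType F) (br : trilinear_op V).
Hypothesis brL : is_threeLie br.

Let br12 x y z : br y x z = - br x y z. Proof. by case: brL. Qed.
Let br23 x y z : br x z y = - br x y z. Proof. by case: brL. Qed.

Lemma br_rot x y z : br y z x = br x y z.
Proof. by rewrite br23 br12 opprK. Qed.

(** The fundamental identity in a form that is invariant under cyclic
    permutation of x1, x2, x3. *)
Lemma fundamental x1 x2 x3 y z :
  br (br x1 x2 x3) y z =
  br (br x1 y z) x2 x3 + br (br x2 y z) x3 x1 + br (br x3 y z) x1 x2.
Proof.
case: brL => _ _ _ FI; rewrite FI.
by rewrite -[br x1 _ x3]br_rot [br x1 x2 (br x3 _ _)]br_rot.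
Qed.

(** Let e_i, g_i and a_i be [[x_j, x_k, z], x_i, y], [[x_j, x_k, y], x_i, z] and
    [[x_i, y, z], x_j, x_k] for (i, j, k) cyclic.  The fundamental identity
    gives e_i = - g_k - g_j + a_i and, with y and z exchanged,
    g_i = - e_j - e_k - a_i.  Eliminating g_2 and g_3 from the equation for
    e_1 leaves e_1 + e_2 + e_3 + a_1 + a_2 + a_3 = 0, where a_1 + a_2 + a_3 is
    the left-hand side. *)
Lemma fundamental_mixed x1 x2 x3 y z :
  br (br x1 x2 x3) y z =
  - br (br x2 x3 z) x1 y - br (br x3 x1 z) x2 y - br (br x1 x2 z) x3 y.
Proof.
have EE i j k u v : br (br j k v) i u =
    - br (br i j u) k v - br (br k i u) j v + br (br i u v) j k.
  rewrite fundamental; congr (_ + _ + _).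
  - by rewrite [br j i u]br12 brNl.
  - by rewrite br23.
  - by rewrite -[br v i u]br_rot.
set e1 := br (br x2 x3 z) x1 y; set e2 := br (br x3 x1 z) x2 y.
set e3 := br (br x1 x2 z) x3 y.
rewrite fundamental; set a1 := br _ x2 x3; set a2 := br _ x3 x1.
set a3 := br _ x1 x2.
have e1E : e1 = (e2 + e1 + a3) + (e1 + e3 + a2) + a1.
  rewrite {1}/e1 EE -/a1; congr (_ + _).
  have -> : br (br x1 x2 y) x3 z = - e2 - e1 - a3.
    by rewrite EE [br x3 z y]br23 brNl.
  have -> : br (br x3 x1 y) x2 z = - e1 - e3 - a2.
    by rewrite EE [br x2 z y]br23 brNl.
  by rewrite !opprD !opprK.
apply/eqP; rewrite -subr_eq0 !opprD !opprK; apply/eqP; apply: (addrI e1).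
by rewrite addr0 {3}e1E [RHS](AC (3*3*1) (2*((7*6*3)*(4*1*5)))).
Qed.

End ThreeLieIdentities.

(** * The coadjoint extension *)

Section CoadjointRepresentation.
Variables (F : fieldType) (V : lmodType F) (br : trilinear_op V).
Hypothesis brL : is_threeLie br.
Implicit Types (f g : dual V) (x y z : V).

Lemma coadE x y f z : coad br x y f z = - f (br x y z) :> F.
Proof. by []. Qed.
Lemma dual_addE f g x : (f + g) x = f x + g x :> F.
Proof. by []. Qed.
Lemma dual_oppE f x : (- f) x = - f x :> F.
Proof. by []. Qed.
Lemma dual_scaleE (a : F) f x : (a *: f) x = a * f x :> F.
Proof. by []. Qed.
Lemma dual_compE f (D : {linear V -> V}) x : dual_comp f D x = f (D x) :> F.
Proof. by []. Qed.
Lemma dualD f x y : f (x + y) = f x + f y :> F. Proof. exact: linearD. Qed.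
Lemma dualN f x : f (- x) = - f x :> F. Proof. exact: linearN. Qed.
Lemma dualZ f a x : f (a *: x) = a * f x :> F. Proof. by rewrite linearZ. Qed.

Definition dualE := (coadE, dual_addE, dual_oppE, dual_scaleE, dual_compE,
  dualD, dualN, dualZ).

Let br12 x y z : br y x z = - br x y z. Proof. by case: brL. Qed.
Let br23 x y z : br x z y = - br x y z. Proof. by case: brL. Qed.

Lemma coadC x y f : coad br y x f = - coad br x y f.
Proof. by apply: dual_ext => z; rewrite !dualE br12 dualN. Qed.

(** The operator ad^*(y2, y3) acts as a derivation on ad^*(x2, x3); dually, this
    is the fundamental identity for [[x2, x3, z], y2, y3]. *)
Lemma coad_comm x2 x3 y2 y3 f :
  coad br y2 y3 (coad br x2 x3 f) =
  coad br x2 x3 (coad br y2 y3 f)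
  + coad br (br x2 y2 y3) x3 f + coad br x2 (br x3 y2 y3) f.
Proof.
apply: dual_ext => z; rewrite !dualE.
have -> : br y2 y3 (br x2 x3 z) =
   br x2 x3 (br y2 y3 z) + br (br x2 y2 y3) x3 z + br x2 (br x3 y2 y3) z.
  rewrite (br_rot brL (br x2 x3 z)); case: (brL) => _ _ _ ->.
  by rewrite -(br_rot brL z) -[RHS]addrA [RHS]addrC.
by rewrite !dualE; ring.
Qed.

(** The transpose of fundamental_mixed. *)
Lemma coad_bracket x1 x2 x3 y g :
  coad br (br x1 x2 x3) y g =
  coad br x2 x3 (coad br x1 y g) - coad br x1 x3 (coad br x2 y g)
  + coad br x1 x2 (coad br x3 y g).
Proof.
apply: dual_ext => z; rewrite !dualE (fundamental_mixed brL).
by rewrite !(br_rot brL (br _ _ _)) (br12 x3 x1) brNl !dualE; ring.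
Qed.

Local Notation brW := (coext_bracket br).
Local Notation B := (@coext_form F V).

Lemma coext_trilinear : trilinear brW.
Proof.
split=> [v w|u w|u v] a [x f] [y g]; congr (_, _);
  rewrite /= ?(brPl, brPm, brPr) //;
  apply: dual_ext => z; rewrite !dualE ?(brPl, brPm, brPr) !dualE; ring.
Qed.

(** In the dual component of the fundamental identity, the terms in which the
    form comes from one of the first three arguments match by coad_comm, those
    in which it comes from one of the last two by coad_bracket. *)
Lemma coext_threeLie : is_threeLie brW.
Proof.
split; first exact: coext_trilinear.
- move=> [x f] [y g] [z h]; congr (_, _) => /=; first exact: br12.
  by rewrite (coadC x y); apply: dual_ext => t; rewrite !dualE; ring.
- move=> [x f] [y g] [z h]; congr (_, _) => /=; first exact: br23.
  by rewrite (coadC y z); apply: dual_ext => t; rewrite !dualE; ring.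
move=> [x1 f1] [x2 f2] [x3 f3] [y2 g2] [y3 g3]; congr (_, _) => /=.
  by case: brL.
have coadD x y f g : coad br x y (f + g) = coad br x y f + coad br x y g.
  by apply: dual_ext => z; rewrite !dualE; ring.
have coadN x y f : coad br x y (- f) = - coad br x y f.
  by apply: dual_ext => z; rewrite !dualE.
rewrite !(coadD, coadN) !(coad_comm _ _ y2 y3) !coad_bracket.
(* What remains is an equality of sums of coadjoint terms, kept opaque here. *)
move: (coad br) => K; apply: dual_ext => z.
by rewrite !(dual_addE, dual_oppE); ring.
Qed.

Lemma coext_formE x f y g : B (x, f) (y, g) = f y + g x.
Proof. by []. Qed.

Lemma coext_metric : is_metric brW B.
Proof.
split.
- split=> [[y g] a [x f] [x' f']|[x f] a [y g] [y' g']].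
    rewrite -[a *: (x, f) + _]/(a *: x + x', a *: f + f') !coext_formE !dualE.
    by rewrite -[RHS]/(a * (f y + g x) + (f' y + g x') : F); ring.
  rewrite -[a *: (y, g) + _]/(a *: y + y', a *: g + g') !coext_formE !dualE.
  by rewrite -[RHS]/(a * (f y + g x) + (f y' + g' x) : F); ring.
- by move=> [x f] [y g]; rewrite /coext_form addrC.
- move=> [x f] xf0; congr (_, _).
    apply: dual_separates => g; have := xf0 (0, g).
    by rewrite /coext_form /= linear0 add0r.
  by apply: dual_ext => y; have := xf0 (y, 0); rewrite /coext_form /= addr0.
move=> [x1 f1] [x2 f2] [x3 f3] [x4 f4]; rewrite /coext_form /= !dualE.
by rewrite (br23 x2 x3 x4) (br23 x1 x3 x4) !dualE; ring.
Qed.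

Lemma coext_mapE (D : {linear V -> V}) x f :
  coext_map D (x, f) = (D x, - dual_comp f D).
Proof. by []. Qed.

Lemma coext_form_map_skew (D : {linear V -> V}) u v :
  B (coext_map D u) v + B u (coext_map D v) = 0.
Proof.
by case: u v => [x f] [y g]; rewrite !(coext_mapE, coext_formE) !dualE; ring.
Qed.

Lemma coext_map_linear (D : {linear V -> V}) : linear (coext_map D).
Proof.
move=> a [x f] [y g]; congr (_, _); first exact: linearP.
by apply: dual_ext => z; rewrite !dualE; ring.
Qed.

Lemma coext_map_DerB (D : {linear V -> V}) :
  is_derivation br D -> is_DerB brW B (coext_map D).
Proof.
case=> _ Dbr; split; last exact: coext_form_map_skew.
split; first exact: coext_map_linear.
move=> [x f] [y g] [z h]; congr (_, _); first exact: Dbr.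
by apply: dual_ext => w; rewrite /= !dualE !Dbr !dualE; ring.
Qed.

Lemma coext_map_bij (D : {linear V -> V}) :
  bijective D -> bijective (coext_map D).
Proof.
case=> E DK EK.
have E_lin : linear E by exact: can2_linear DK EK.
exists (coext_map (lin_of E_lin)) => -[x f]; congr (_, _) => //=.
  by apply: dual_ext => y; rewrite !dualE /= opprK EK.
by apply: dual_ext => y; rewrite !dualE /= opprK DK.
Qed.

End CoadjointRepresentation.

(** * Symplectic structures from skew derivations *)

Section SymplecticFromMetric.
Variables (F : fieldType) (V : lmodType F) (br : V -> V -> V -> V).
Variables (B : V -> V -> F) (D : V -> V).

Lemma symplectic_of_DerB :
  is_metric_threeLie br B -> is_DerB br B D -> injective D ->
  is_symplectic_structure br (fun u v => B (D u) v).
Proof.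
move=> [[_ br12 br23 _] [[Bl Br] Bsym Bnd Binv]] [[Dlin Dbr] Dskew] Dinj.
have BD x y z : B (x + y) z = B x z + B y z := linearD (lin_of (Bl z)) x y.
have BN x z : B (- x) z = - B x z := linearN (lin_of (Bl z)) x.
have D0 : D 0 = 0 := linear0 (lin_of Dlin).
have Dop x y : B (D x) y = - B x (D y) by apply/eqP; rewrite -addr_eq0 Dskew.
have Bop x y z t : B (br x y z) t = - B (br x y t) z.
  by rewrite [B (br x y t) z]Bsym; apply/eqP; rewrite -addr_eq0 Binv.
split.
- split=> [v a u u'|u a v v']; last exact: Br.
  by rewrite Dlin Bl.
- by move=> x y; rewrite Dop Bsym.
- by move=> x Dx0; apply: Dinj; rewrite D0; apply: Bnd.
move=> x1 x2 x3 x4.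
(* In the first three terms D moves to the second argument of B, and then
   invariance brings it inside the bracket; the last term expands by the
   derivation rule into the opposite of their sum. *)
have r x y z : br y z x = br x y z by rewrite br23 br12 opprK.
rewrite (Dop _ x1) (Dop _ x2) (Dop _ x3) Dbr !BD.
rewrite (Bop x2) (Bop x1 x3) (Bop x1 x2 x4) (r (D x1)) [br x1 x3 _]br23 BN.
by ring.
Qed.

End SymplecticFromMetric.

(** * Coordinates on the tensor product *)

Section TensorCoordinates.
Variables (F : fieldType) (L T : lmodType F) (n : nat).
Hypothesis n_gt1 : (1 < n)%N.
Variable tens : L -> tquot F n -> T.
Hypothesis tensP : is_tensor_product tens.

Let tens_lin_l w : {linear L -> T} := lin_of (tensP.1.1 w).
Let tens_lin_r x : {linear tquot F n -> T} := lin_of (tensP.1.2 x).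

Lemma tens_linear_l a x y w : tens (a *: x + y) w = a *: tens x w + tens y w.
Proof. exact: (linearP (tens_lin_l w)). Qed.
Lemma tens_Zl a x w : tens (a *: x) w = a *: tens x w.
Proof. by rewrite -[LHS]/(tens_lin_l w _) linearZ. Qed.
Lemma tens_Dl x y w : tens (x + y) w = tens x w + tens y w.
Proof. exact: (linearD (tens_lin_l w)). Qed.
Lemma tens_Nl x w : tens (- x) w = - tens x w.
Proof. exact: (linearN (tens_lin_l w)). Qed.
Lemma tens_0l w : tens 0 w = 0.
Proof. exact: (linear0 (tens_lin_l w)). Qed.
Lemma tens_0r x : tens x 0 = 0.
Proof. exact: (linear0 (tens_lin_r x)). Qed.

Lemma tens_tbar_eq0 x p : (n <= p)%N -> tens x (tbar F n p) = 0.
Proof. by move=> np; rewrite tbar_eq0 ?tens_0r// np ltnW. Qed.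

(** The coordinate map is induced by the bilinear map (x, w) |-> (w_(i+1) x)_i.
    Summing the components back is the identity on pure tensors, hence
    everywhere by uniqueness in the universal property. *)
Lemma tensor_coordinates :
  exists c : {linear T -> {ffun 'I_n.-1 -> L}},
    (forall x w i, c (tens x w) i = (tcoef i.+1 w : F) *: x) /\
    (forall u, u = \sum_i tens (c u i) (tbar F n i.+1)).
Proof.
pose b (x : L) (w : tquot F n) : {ffun 'I_n.-1 -> L} :=
  [ffun i : 'I_n.-1 => (tcoef i.+1 w : F) *: x].
have b_bil : bilinear_map b.
  split=> [w a x y|x a u v]; apply/ffunP => i; rewrite !ffunE.
    by rewrite scalerDr !scalerA mulrC.
  by rewrite linearP /= scalerDl scalerA.
have [c cE _] := tensP.2 _ _ b_bil.
exists c; split=> [x w i|u]; first by rewrite cE ffunE.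
pose r u := \sum_i tens (c u i) (tbar F n i.+1).
have r_lin : linear r.
  move=> a v w; rewrite /r scaler_sumr -big_split; apply: eq_bigr => i _ /=.
  by rewrite linearP !ffunE tens_linear_l.
have [f _ f_uniq] := tensP.2 _ _ tensP.1.
rewrite -/(r u) -[r u]/(lin_of r_lin u) (f_uniq (lin_of r_lin)) => [|x w].
  exact: (f_uniq (@idfun T : {linear T -> T})).
rewrite /= /r [in RHS](tquot_expand n_gt1 w).
rewrite -[RHS]/(tens_lin_r x _) linear_sum; apply: eq_bigr => i _.
by rewrite cE ffunE tens_Zl linearZ.
Qed.

Lemma tensor_ind (P : T -> Prop) :
  P 0 -> (forall u v, P u -> P v -> P (u + v)) ->
  (forall x p, (0 < p < n)%N -> P (tens x (tbar F n p))) -> forall u, P u.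
Proof.
move=> P0 PD Ptens u; have [c [_ cE]] := tensor_coordinates; rewrite (cE u).
apply: big_ind => // i _; apply: Ptens.
by rewrite /= -ltn_predRL.
Qed.

Lemma degree_map_uniq (D D' : {linear T -> T}) :
  is_degree_map tens D -> is_degree_map tens D' -> D' =1 D.
Proof.
move=> DP D'P; elim/tensor_ind => [|u v Hu Hv|x p pn].
- by rewrite !linear0.
- by rewrite !linearD Hu Hv.
by rewrite D'P// DP.
Qed.

Variable c : {linear T -> {ffun 'I_n.-1 -> L}}.
Hypothesis c_tens : forall x w i, c (tens x w) i = (tcoef i.+1 w : F) *: x.
Hypothesis c_expand : forall u, u = \sum_i tens (c u i) (tbar F n i.+1).

(** A sum over the coordinates of x (x) t^p has the single term of index p - 1.
    For n <= p the tensor is zero and both sides vanish; this case lets the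
    lemma apply without a bound on the exponent. *)
Lemma sum_coord_tens (Z : zmodType) (G : L -> nat -> Z) x p : (0 < p)%N ->
  (forall q, G 0 q = 0) -> (forall y, (n <= p)%N -> G y p = 0) ->
  \sum_(i < n.-1) G (c (tens x (tbar F n p)) i) i.+1 = G x p.
Proof.
move=> p_gt0 G0 Gbig; case: (leqP n p) => np.
  by rewrite Gbig// tens_tbar_eq0// linear0 big1// => i _; rewrite ffunE.
have lt_p : (p.-1 < n.-1)%N by rewrite -ltnS !prednK// ltnW.
rewrite (bigD1 (Ordinal lt_p))//= big1 ?addr0 => [|i /eqP ip].
  by rewrite c_tens tcoef_tbar ?p_gt0//= prednK// eqxx scale1r.
rewrite c_tens tcoef_tbar ?p_gt0//.
case: eqP => [ipE|_]; last by rewrite scale0r.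
by case: ip; apply: val_inj; rewrite /= -ipE.
Qed.

(** * Diagonal maps and the degree map *)

Section WeightMap.
Variable a : nat -> F.

(** Diagonal maps are taken with arbitrary weights because the inverse of the
    degree map is the one with weights p^-1. *)
Definition weight_map u : T :=
  \sum_(i < n.-1) a i.+1 *: tens (c u i) (tbar F n i.+1).

Lemma weight_map_linear : linear weight_map.
Proof.
move=> k u v; rewrite /weight_map scaler_sumr -big_split.
apply: eq_bigr => i _ /=.
by rewrite linearP !ffunE tens_linear_l scalerDr !scalerA mulrC.
Qed.

Lemma weight_map_tens x p : (0 < p)%N ->
  weight_map (tens x (tbar F n p)) = a p *: tens x (tbar F n p).
Proof.
move=> p_gt0; pose G y q := a q *: tens y (tbar F n q).
apply: (sum_coord_tens (G := G)) => //; rewrite /G.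
  by move=> q; rewrite tens_0l scaler0.
by move=> y np; rewrite tens_tbar_eq0// scaler0.
Qed.

End WeightMap.

Lemma weight_mapK (a b : nat -> F) :
  (forall p, (0 < p < n)%N -> b p * a p = 1) ->
  cancel (weight_map a) (weight_map b).
Proof.
move=> ba u; pose A := lin_of (weight_map_linear a).
pose B := lin_of (weight_map_linear b); rewrite -[LHS]/(B (A u)).
elim/tensor_ind: u => [|u v Hu Hv|x p pn].
- by rewrite !linear0.
- by rewrite !linearD Hu Hv.
have [p0 _] := andP pn.
rewrite /= weight_map_tens// -[LHS]/(B _) linearZ /= weight_map_tens//.
by rewrite scalerA mulrC ba// scale1r.
Qed.

(** * Existence of the truncated bracket *)

Section Bracket.
Variable brL : L -> L -> L -> L.
Hypothesis brL_trilinear : trilinear brL.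

Definition trunc_bracket u v w : T :=
  \sum_(i < n.-1) \sum_(j < n.-1) \sum_(k < n.-1)
    tens (brL (c u i) (c v j) (c w k)) (tbar F n (i.+1 + j.+1 + k.+1)).

Lemma trunc_bracket_trilinear : trilinear trunc_bracket.
Proof.
have [H1 H2 H3] := brL_trilinear.
split=> [v w|u w|u v] a x y; rewrite /trunc_bracket scaler_sumr -big_split;
  apply: eq_bigr => i _; rewrite /= scaler_sumr -big_split;
  apply: eq_bigr => j _; rewrite /= scaler_sumr -big_split;
  apply: eq_bigr => k _; rewrite /= linearP !ffunE ?(H1, H2, H3);
  exact: tens_linear_l.
Qed.

Lemma trunc_bracketP : is_truncated_bracket tens brL trunc_bracket.
Proof.
have [H1 H2 H3] := brL_trilinear.
have b0l y z : brL 0 y z = 0 := linear0 (lin_of (H1 y z)).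
have b0m x z : brL x 0 z = 0 := linear0 (lin_of (H2 x z)).
have b0r x y : brL x y 0 = 0 := linear0 (lin_of (H3 x y)).
move=> x y z p q r p0 q0 r0; rewrite /trunc_bracket.
pose G1 x' p' := \sum_(j < n.-1) \sum_(k < n.-1)
  tens (brL x' (c (tens y (tbar F n q)) j) (c (tens z (tbar F n r)) k))
       (tbar F n (p' + j.+1 + k.+1)).
rewrite (sum_coord_tens (G := G1)) //; last 2 first.
- move=> p'; rewrite /G1 big1// => j _; rewrite big1// => k _.
  by rewrite b0l tens_0l.
- move=> x' np; rewrite /G1 big1// => j _; rewrite big1// => k _.
  by rewrite tens_tbar_eq0// -addnA (leq_trans np)// leq_addr.
pose G2 y' q' := \sum_(k < n.-1)
  tens (brL x y' (c (tens z (tbar F n r)) k)) (tbar F n (p + q' + k.+1)).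
rewrite /G1 (sum_coord_tens (G := G2)) //; last 2 first.
- by move=> q'; rewrite /G2 big1// => k _; rewrite b0m tens_0l.
- move=> y' nq; rewrite /G2 big1// => k _.
  by rewrite tens_tbar_eq0// (leq_trans nq)// addnAC leq_addl.
pose G3 z' r' := tens (brL x y z') (tbar F n (p + q + r')).
rewrite /G2 (sum_coord_tens (G := G3)) //; rewrite /G3.
  by move=> r'; rewrite b0r tens_0l.
by move=> z' nr; rewrite tens_tbar_eq0// (leq_trans nr)// leq_addl.
Qed.

End Bracket.

(** * Properties of the truncated bracket *)

Section TruncatedBracket.
Variables (brL : L -> L -> L -> L) (br : trilinear_op T).
Hypothesis brP : is_truncated_bracket tens brL br.

Lemma truncated_bracket_uniq (br' : trilinear_op T) :
  is_truncated_bracket tens brL br' -> forall u v w, br' u v w = br u v w.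
Proof.
move=> br'P u v w; elim/tensor_ind: u => [|u u' Hu Hu'|x p /andP[p0 _]].
- by rewrite !br0l.
- by rewrite !brDl Hu Hu'.
elim/tensor_ind: v => [|v v' Hv Hv'|y q /andP[q0 _]].
- by rewrite !br0m.
- by rewrite !brDm Hv Hv'.
elim/tensor_ind: w => [|w w' Hw Hw'|z r /andP[r0 _]].
- by rewrite !br0r.
- by rewrite !brDr Hw Hw'.
by rewrite brP// br'P.
Qed.

Lemma truncated_bracket_threeLie : is_threeLie brL -> is_threeLie br.
Proof.
case=> _ L12 L23 LFI; split; first exact: trilinearP.
- move=> u v w; elim/tensor_ind: u => [|u u' Hu Hu'|x p /andP[p0 _]].
  + by rewrite br0l br0m oppr0.
  + by rewrite brDl brDm Hu Hu' opprD.
  elim/tensor_ind: v => [|v v' Hv Hv'|y q /andP[q0 _]].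
  + by rewrite br0l br0m oppr0.
  + by rewrite brDl brDm Hv Hv' opprD.
  elim/tensor_ind: w => [|w w' Hw Hw'|z r /andP[r0 _]].
  + by rewrite !br0r oppr0.
  + by rewrite !brDr Hw Hw' opprD.
  by rewrite !brP// L12 tens_Nl (addnC q).
- move=> u v w; elim/tensor_ind: u => [|u u' Hu Hu'|x p /andP[p0 _]].
  + by rewrite !br0l oppr0.
  + by rewrite !brDl Hu Hu' opprD.
  elim/tensor_ind: v => [|v v' Hv Hv'|y q /andP[q0 _]].
  + by rewrite br0m br0r oppr0.
  + by rewrite brDm brDr Hv Hv' opprD.
  elim/tensor_ind: w => [|w w' Hw Hw'|z r /andP[r0 _]].
  + by rewrite br0m br0r oppr0.
  + by rewrite brDm brDr Hw Hw' opprD.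
  by rewrite !brP// L23 tens_Nl addnAC.
move=> u1 u2 u3 v2 v3.
elim/tensor_ind: u1 => [|u u' Hu Hu'|x1 p1 /andP[p1_gt0 _]].
- by rewrite !br0l !addr0.
- by rewrite !brDl Hu Hu' addr3ACA.
elim/tensor_ind: u2 => [|u u' Hu Hu'|x2 p2 /andP[p2_gt0 _]].
- by rewrite !(br0l, br0m) !addr0.
- by rewrite !(brDl, brDm) Hu Hu' addr3ACA.
elim/tensor_ind: u3 => [|u u' Hu Hu'|x3 p3 /andP[p3_gt0 _]].
- by rewrite !(br0l, br0r) !addr0.
- by rewrite !(brDl, brDr) Hu Hu' addr3ACA.
elim/tensor_ind: v2 => [|u u' Hu Hu'|y2 q2 /andP[q2_gt0 _]].
- by rewrite !(br0m, br0l, br0r) !addr0.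
- by rewrite !(brDm, brDl, brDr) Hu Hu' addr3ACA.
elim/tensor_ind: v3 => [|u u' Hu Hu'|y3 q3 /andP[q3_gt0 _]].
- by rewrite !(br0r, br0m, br0l) !addr0.
- by rewrite !(brDr, brDm, brDl) Hu Hu' addr3ACA.
rewrite !brP ?addn_gt0 ?p1_gt0 ?p2_gt0 ?p3_gt0// LFI !tens_Dl.
by congr (tens _ (tbar _ _ _) + tens _ (tbar _ _ _) + tens _ (tbar _ _ _));
  ring.
Qed.

Lemma degree_map_derivation (D : {linear T -> T}) :
  is_degree_map tens D -> is_derivation br D.
Proof.
move=> DP; split; first exact: linearP.
have Dtens x p : (0 < p)%N ->
    D (tens x (tbar F n p)) = p%:R *: tens x (tbar F n p).
  move=> p_gt0; case: (ltnP p n) => np; first by rewrite DP ?p_gt0.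
  by rewrite tens_tbar_eq0// linear0 scaler0.
move=> u v w; elim/tensor_ind: u => [|u u' Hu Hu'|x p /andP[p0 _]].
- by rewrite !(br0l, linear0) !addr0.
- by rewrite !(brDl, linearD) Hu Hu' addr3ACA.
elim/tensor_ind: v => [|u u' Hu Hu'|y q /andP[q0 _]].
- by rewrite !(br0m, linear0) !addr0.
- by rewrite !(brDm, linearD) Hu Hu' addr3ACA.
elim/tensor_ind: w => [|u u' Hu Hu'|z r /andP[r0 _]].
- by rewrite !(br0r, linear0) !addr0.
- by rewrite !(brDr, linearD) Hu Hu' addr3ACA.
rewrite brP// !Dtens ?addn_gt0 ?p0// brZl brZm brZr brP//.
by rewrite -!scalerDl -!natrD.
Qed.

(** The filtration by order in t: the coordinate of index i belongs to
    t^(i+1), so vanishing below m means divisibility by t^(m+1). *)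
Definition vanishes_below m u := forall i : 'I_n.-1, (i < m)%N -> c u i = 0.

Lemma vanishes_below0 m : vanishes_below m 0.
Proof. by move=> i _; rewrite linear0 ffunE. Qed.

Lemma vanishes_belowD m u v :
  vanishes_below m u -> vanishes_below m v -> vanishes_below m (u + v).
Proof. by move=> um vm i im; rewrite linearD ffunE um// vm// addr0. Qed.

Lemma bracket_raises_order m u v w :
  vanishes_below m u -> vanishes_below m.+1 (br u v w).
Proof.
move=> um; have -> : br u v w = \sum_i br (tens (c u i) (tbar F n i.+1)) v w.
  by rewrite {1}(c_expand u) br_suml.
apply: big_ind => [||i _]; [exact: vanishes_below0|exact: vanishes_belowD|].
have [im|mi] := ltnP i m.
  by rewrite um// tens_0l br0l; apply: vanishes_below0.
elim/tensor_ind: v => [|v v' Hv Hv'|y q /andP[q0 _]].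
- by rewrite br0m; apply: vanishes_below0.
- by rewrite brDm; apply: vanishes_belowD.
elim/tensor_ind: w => [|w w' Hw Hw'|z r /andP[r0 _]].
- by rewrite br0r; apply: vanishes_below0.
- by rewrite brDr; apply: vanishes_belowD.
rewrite brP//; case: (ltnP (i.+1 + q + r) n) => big; last first.
  by rewrite tens_tbar_eq0//; apply: vanishes_below0.
move=> l lm; rewrite c_tens tcoef_tbar//.
have /ltn_eqF -> : (l.+1 < i.+1 + q + r)%N.
  rewrite -addnA (leq_ltn_trans (leq_trans lm (mi : m < i.+1)%N))//.
  by rewrite -[X in (X < _)%N]addn0 ltn_add2l addn_gt0 q0.
by rewrite scale0r.
Qed.

Lemma lower_central_order s u : lower_central br s u -> vanishes_below s u.
Proof.
elim: s u => [|s IHs] u //= [m [a [e [eP ->]]]].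
apply: big_ind => [||i _]; [exact: vanishes_below0|exact: vanishes_belowD|].
have [x [y [z [xs ->]]]] := eP i.
rewrite -brZl; apply: bracket_raises_order => j js.
by rewrite linearZ ffunE (IHs _ xs)// scaler0.
Qed.

Lemma truncated_bracket_nilpotent : nilpotent_threeLie br.
Proof.
exists n.-1; apply/seteqP; split=> [u uP|_ ->] /=.
  rewrite (c_expand u) big1// => i _.
  by rewrite (lower_central_order uP)// tens_0l.
case: n.-1 => [|k] //=; exists 0%N, (fun=> 0), (fun=> 0).
by split=> [[]//|]; rewrite big_ord0.
Qed.

End TruncatedBracket.

End TensorCoordinates.

(** * The theorem *)

Theorem mainTheorem2 (F : closedFieldType) (charF0 : [pchar F] =i pred0)
    (L : lmodType F) (brL : L -> L -> L -> L) (brL_lie : is_threeLie brL)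
    (n : nat) (n_gt2 : (2 < n)%N)
    (Ln : lmodType F) (tens : L -> tquot F n -> Ln)
    (tensP : is_tensor_product tens) :
  exists (br : trilinear_op Ln) (D : {linear Ln -> Ln}),
    [/\ is_truncated_bracket tens brL br,
        forall br' : trilinear_op Ln, is_truncated_bracket tens brL br' ->
          forall u v w, br' u v w = br u v w,
        is_threeLie br &
        nilpotent_threeLie br] /\
    [/\ is_degree_map tens D,
        forall D' : {linear Ln -> Ln}, is_degree_map tens D' -> D' =1 D,
        bijective D &
        is_derivation br D] /\
    is_metric_threeLie (coext_bracket br) (@coext_form F Ln) /\
    (bijective (coext_map D) /\
     is_DerB (coext_bracket br) (@coext_form F Ln) (coext_map D)) /\
    ((forall (x y : Ln) (f g : dual Ln),
        coext_omega D (x, f) (y, g) = - f (D y) + g (D x)) /\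
     is_symplectic_structure (coext_bracket br) (coext_omega D)) /\
    is_metric_symplectic (coext_bracket br) (@coext_form F Ln) (coext_omega D).
Proof.
have n_gt1 : (1 < n)%N by apply: leq_trans n_gt2.
have [c [c_tens c_expand]] := tensor_coordinates n_gt1 tensP.
have brL_tri : trilinear brL by case: brL_lie.
pose br := TrilinearOp (trunc_bracket_trilinear tensP c brL_tri).
have brP : is_truncated_bracket tens brL br.
  exact: (trunc_bracketP n_gt1 tensP c_tens brL_tri).
pose D := lin_of (weight_map_linear tensP c (fun p => p%:R)).
have DP : is_degree_map tens D.
  by move=> x p /andP[p0 _]; apply: (weight_map_tens n_gt1 tensP c_tens).
have br_lie := truncated_bracket_threeLie n_gt1 tensP brP brL_lie.
have Dder := degree_map_derivation n_gt1 tensP brP DP.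
have Dbij : bijective D.
  have nat_neq0 p : (0 < p < n)%N -> p%:R != 0 :> F.
    by case/andP=> p0 _; rewrite (pcharf0P _).1// -lt0n.
  exists (weight_map tens c (fun p => p%:R^-1)) => u;
    apply: (weight_mapK n_gt1 tensP c_tens) => p /nat_neq0 pn.
    by rewrite mulVf.
  by rewrite mulfV.
have met : is_metric_threeLie (coext_bracket br) (@coext_form F Ln).
  by split; [exact: coext_threeLie | exact: coext_metric].
have DerB := coext_map_DerB Dder.
have Tbij := coext_map_bij Dbij.
have symp : is_symplectic_structure (coext_bracket br) (coext_omega D).
  exact: (symplectic_of_DerB met DerB (bij_inj Tbij)).
have br_uniq := truncated_bracket_uniq n_gt1 tensP brP.
have br_nil := truncated_bracket_nilpotent n_gt1 tensP c_tens c_expand brP.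
have D_uniq D' := @degree_map_uniq _ _ _ _ n_gt1 _ tensP D D' DP.
exists br, D; split; first by [].
split; first by [].
split; first exact: met.
split; first exact: (conj Tbij DerB).
by split; [split | exact: (conj met symp)].
Qed.
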